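(* Let $k=pq$, where $p$ and $q$ are distinct odd primes. Let $A$ be a finite set of integers such that $|A|>8k^k$. Then \[|2\cdot A+k\cdot A|\ge (k+2)|A|-k^2-k+2.\]
   Context: For an integer $m$ and a set $A$ of integers, $m\cdot A=\{ma : a\in A\}$ denotes the $m$-dilation of $A$. Sums of sets are Minkowski sums, so $2\cdot A+k\cdot A=\{2a_1+ka_2 : a_1,a_2\in A\}$. $|S|$ denotes the cardinality of a finite set $S$. *)

(* Defs.v *)
From mathcomp Require Import all_boot all_order all_algebra.
From mathcomp Require Import finmap.

Set Implicit Arguments.
Unset Strict Implicit.
Unset Printing Implicit Defensive.

Import GRing.Theory Num.Theory.
Local Open Scope fset_scope.
Local Open Scope ring_scope.

Definition dilate (m : int) (A : {fset int}) : {fset int} :=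
  [fset m * a | a in A].

Definition sumset (A B : {fset int}) : {fset int} :=
  [fset a + b | a in A, b in B].

(* Main.v *)
Require Import Defs.
From HB Require Import structures.
From mathcomp Require Import all_boot all_order all_algebra.
From mathcomp Require Import finmap zify ring lra.

(** Write 2A + kA for the sum of dilates and split A into its classes
    A_i = k X_i + u_i modulo k = pq. The sets 2A_i + kA lie in distinct classes
    modulo k because k is odd, and 2A_i + kA is an affine copy of 2X_i + A, so
    |2A + kA| is at least the sum over i of t_i = |2X_i + A|. After translating
    and dividing by the gcd of the differences, A contains both parities and is
    not contained in one class modulo p or modulo q.

    Splitting A by parity gives t_i >= 2|X_i| + |A| - 2, which settles the case
    where A meets all k classes. If X_i meets all classes modulo k, then
    t_i >= 2|X_i| + k|A_l| - 2k for every l ([full_dsum_ge]). Otherwise compare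
    2X_i + A with its subset 2X_i + A_i, whose size is that of 2A_i + kA_i and can
    be bounded inductively: the residue set V of 2X_i is proper, so a translation
    by l - i that does not preserve V produces a new residue class, and in it a
    gain of |A_l| elements ([gain_of_moved]). The stabilizer of V is
    trivial, or the subgroup of order p, or the one of order q. In the last two
    cases no gain is guaranteed from the A_l in the coset of i, but every A_l
    outside it gives a gain of p|A_l|, respectively q|A_l| ([FpFq_gain]).

    The key point is that these gains always add up to |A| ([total_gain]). If the
    largest class A_l1 shares a column (a class modulo q) with another class that
    gains less than |A_l1|, then the classes outside the column are small, and
    for any one of them, say A_i, working modulo q instead of modulo k shows that
    2X_i + A either gains the size of the whole column or has at least q times
    that size ([line_gain], [column_gain]).
    Therefore the bound |2S + kS| >= (m + 2)|S| - C for all S implies the same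
    bound with m + 1 and kC, as long as m < k ([weak_bound_step]); from m = 2 this
    leads to |2S + kS| >= (k + 2)|S| - 4k^(k-1) for all nonempty S.

    For |A| > 8k^k the constant is absorbed ([strong_bound]). A small
    class has t_i at least |A| - 2, much more than it needs. If all classes are large,
    one X_i that is not full gains more than all the losses. If all X_i are full,
    a refinement of the full case that counts how many classes of A have maximal
    size ([full_family_ge]) shows that with j classes the loss is at most
    2j(k + 1 - j), which is at most k^2 + k - 2. *)

Set Implicit Arguments.
Unset Strict Implicit.
Unset Printing Implicit Defensive.

Import Order.TTheory GRing.Theory Num.Theory.
Local Open Scope fset_scope.
Local Open Scope ring_scope.

(* Needed for products of prime fields to be finite abelian groups. *)
HB.saturate prod.

Local Notation dsum X A := (sumset (dilate 2 X) A) (only parsing).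

(** * Sums of finite sets of integers *)

Lemma sumsetP (A B : {fset int}) z :
  reflect (exists a b, [/\ a \in A, b \in B & z = a + b]) (z \in sumset A B).
Proof.
apply: (iffP (imfset2P _ _ _ _ _)) => [[a Aa [b Bb ->]]|[a [b [Aa Bb ->]]]].
  by exists a, b.
by exists a => //; exists b.
Qed.

Lemma dilateP m (A : {fset int}) z :
  reflect (exists2 a, a \in A & z = m * a) (z \in dilate m A).
Proof. by apply: (iffP (imfsetP _ _ _ _)) => -[a Aa ->]; exists a. Qed.

Lemma card_dilate m (A : {fset int}) : m != 0 -> #|` dilate m A| = #|` A|.
Proof. by move=> m0; apply: card_imfset => x y /(mulfI m0). Qed.

Lemma dsumP (X A : {fset int}) z :
  reflect (exists x a, [/\ x \in X, a \in A & z = 2 * x + a])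
    (z \in dsum X A).
Proof.
apply: (iffP (sumsetP _ _ _)) => [[y [a [/dilateP[x Xx ->] Aa ->]]]|].
  by exists x, a.
by move=> [x [a [Xx Aa ->]]]; exists (2 * x), a; split=> //; apply/dilateP; exists x.
Qed.

Lemma card_shift u (A : {fset int}) : #|` [fset u + a | a in A]| = #|` A|.
Proof. by apply: card_imfset => x y /addrI. Qed.

Lemma fset_min (A : {fset int}) : A != fset0 ->
  exists2 m, m \in A & forall x, x \in A -> m <= x.
Proof.
elim/finSet_rect: A => A IH /fset0Pn[a Aa].
have [A0|/(IH _ (fproperD1 Aa))[m]] := eqVneq (A `\ a) fset0.
  exists a => // x Ax; case: (eqVneq x a) => [-> //|xa].
  by have := in_fset0 x; rewrite -A0 !inE xa Ax.
rewrite !inE => /andP[ma Am] min_m.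
exists (Num.min a m); first by rewrite /Num.min; case: ifP.
move=> x Ax; rewrite ge_min; case: (eqVneq x a) => [->|xa]; first by rewrite lexx.
by rewrite min_m ?orbT // !inE xa.
Qed.

Lemma fset_max (A : {fset int}) : A != fset0 ->
  exists2 m, m \in A & forall x, x \in A -> x <= m.
Proof.
move=> A0; have [|m /dilateP[a Aa ->] min_a] := @fset_min (dilate (-1) A).
  case/fset0Pn: A0 => a Aa; apply/fset0Pn; exists (-1 * a).
  by apply/dilateP; exists a.
exists a => // x Ax; have := min_a (-1 * x).
by rewrite !mulN1r lerN2; apply; apply/dilateP; exists x; rewrite ?mulN1r.
Qed.

Lemma leq_card_fsetU_disj (A B T : {fset int}) :
  A `<=` T -> B `<=` T -> (forall x, x \in A -> x \in B -> False) ->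
  (#|` A| + #|` B| <= #|` T|)%N.
Proof.
move=> AT BT dAB; have : A `|` B `<=` T by rewrite fsubUset AT.
move/fsubset_leq_card; rewrite cardfsU; suff -> : A `&` B = fset0.
  by rewrite cardfs0 subn0.
apply/fsetP=> x; rewrite !inE; apply/negP => /andP[]; exact: dAB.
Qed.

(** Removing the largest b from B loses the sum of the two maxima. *)
Lemma card_sumset_ge (A B : {fset int}) : A != fset0 -> B != fset0 ->
  (#|` A| + #|` B| <= #|` sumset A B| + 1)%N.
Proof.
move=> A0; elim/finSet_rect: B => B IH B0.
have [b Bb maxb] := fset_max B0; have [a Aa maxa] := fset_max A0.
have cB := cardfsD1 b B; rewrite Bb in cB.
have [Bb0|/(IH _ (fproperD1 Bb)) {}IH] := eqVneq (B `\ b) fset0.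
  suff: (#|` A| <= #|` sumset A B|)%N by move: cB; rewrite Bb0 cardfs0; lia.
  rewrite -(card_shift b A).
  apply/fsubset_leq_card/fsubsetP => z /imfsetP[/= x Ax ->].
  by apply/sumsetP; exists x, b; rewrite addrC.
have S1 : sumset A (B `\ b) `<=` sumset A B.
  apply/fsubsetP=> z /sumsetP[x [y [Ax yB ->]]].
  by apply/sumsetP; exists x, y; move: yB; rewrite !inE => /andP[].
have S2 : [fset a + b] `<=` sumset A B.
  by rewrite fsub1set; apply/sumsetP; exists a, b.
have := leq_card_fsetU_disj S1 S2; rewrite cardfs1 => lt.
suff {}/lt : forall z, z \in sumset A (B `\ b) -> z \in [fset a + b] -> False.
  by move: IH; rewrite cB; lia.
move=> z /sumsetP[x [y [Ax]]]; rewrite !inE => /andP[yb By] -> /eqP.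
have := maxa _ Ax; have := maxb _ By; move: yb; lia.
Qed.

(** * Counting by residue classes *)

Definition fiber (I : eqType) (phi : int -> I) (A : {fset int}) (c : I) :=
  [fset x in A | phi x == c].

Lemma in_fiber (I : eqType) (phi : int -> I) A c x :
  (x \in fiber phi A c) = (x \in A) && (phi x == c).
Proof. by rewrite !inE. Qed.

Lemma fiber_sub (I : eqType) (phi : int -> I) A c : fiber phi A c `<=` A.
Proof. by apply/fsubsetP => x; rewrite in_fiber => /andP[]. Qed.

Lemma sum_card_fiber (I : finType) (phi : int -> I) A :
  (\sum_c #|` fiber phi A c|)%N = #|` A|.
Proof.
rewrite card_fset_sum1 (partition_big phi predT) //=; apply: eq_bigr => c _.
by rewrite card_fset_sum1 [RHS]big_fset_condE.
Qed.

Lemma leq_sum_card_fibers (I J : finType) (phi : int -> I) (g : J -> I)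
    (F : J -> {fset int}) (T : {fset int}) :
  injective g -> (forall j x, x \in F j -> x \in T /\ phi x = g j) ->
  (\sum_j #|` F j| <= #|` T|)%N.
Proof.
move=> g_inj FT; rewrite -(sum_card_fiber phi T).
apply: (@leq_trans (\sum_j #|` fiber phi T (g j)|)%N).
  apply: leq_sum => j _; apply/fsubset_leq_card/fsubsetP => x /FT[Tx gx].
  by rewrite in_fiber Tx gx eqxx.
rewrite -(big_imset (fun c => #|` fiber phi T c|)) /=; last by move=> ? ? _ _ /g_inj.
by rewrite big_mkcond; apply: leq_sum => c _; case: ifP.
Qed.

Lemma fiberC (I J : eqType) (phi : int -> I) (psi : int -> J) A c d :
  fiber phi (fiber psi A d) c = fiber psi (fiber phi A c) d.
Proof. by apply/fsetP => x; rewrite !in_fiber andbAC. Qed.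

(** * Splitting by parity *)

Definition evenz (a : int) : bool := (2 %| a)%Z.

(** For such A, the sum dsum X A splits into two sums, which doubles the
    contribution of X. *)
Definition mixed (A : {fset int}) := forall e, exists2 a, a \in A & evenz a = e.

Lemma dsum_parity X A :
  (#|` dsum X (fiber evenz A true)| + #|` dsum X (fiber evenz A false)| <=
   #|` dsum X A|)%N.
Proof.
have /= := @leq_sum_card_fibers _ _ evenz id
  (fun e => dsum X (fiber evenz A e)) (dsum X A).
rewrite big_bool /=; apply=> // e z /dsumP[x [a [Xx]]].
rewrite in_fiber => /andP[Aa /eqP <-] ->; split; first by apply/dsumP; exists x, a.
by rewrite /evenz; apply/idP/idP; lia.
Qed.

Lemma card_parity A : (#|` fiber evenz A true| + #|` fiber evenz A false|)%N = #|` A|.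
Proof. by rewrite -(sum_card_fiber evenz A) big_bool. Qed.

Lemma mixed_fiber A e : mixed A -> fiber evenz A e != fset0.
Proof.
move=> /(_ e)[a Aa ea]; apply/fset0Pn; exists a.
by rewrite in_fiber Aa ea eqxx.
Qed.

Lemma dsum_ge X A : X != fset0 -> A != fset0 ->
  (#|` X| + #|` A| <= #|` dsum X A| + 1)%N.
Proof.
move=> X0 A0; rewrite -(@card_dilate 2 X) //; apply: card_sumset_ge => //.
by rewrite -cardfs_gt0 card_dilate // cardfs_gt0.
Qed.

Lemma mixed_dsum_ge X A : X != fset0 -> mixed A ->
  (2 * #|` X| + #|` A| <= #|` dsum X A| + 2)%N.
Proof.
move=> X0 mA; have := dsum_parity X A; have := card_parity A.
have := dsum_ge X0 (mixed_fiber true mA); have := dsum_ge X0 (mixed_fiber false mA).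
lia.
Qed.

(** * Sets meeting every residue class *)

Section Residues.
Variables (R : finZmodType) (phi : int -> R).
Hypothesis phiD : {morph phi : x y / x + y}.

(** Doubled elements are used because the classes that matter are those of 2X.
    For R of odd order this says that X itself meets every class. *)
Definition full (X : {fset int}) := forall c : R, exists2 x, x \in X & phi (2 * x) = c.

(** The least elements m l of the classes l in L already produce |X| + |L| - 1
    sums with 2X. In each residue class let 2x + m l be the largest of these sums:
    the elements 2x + b, where b runs over the rest of the class of l in B, lie
    above it and stay in the residue class, which adds r - 1 sums per class. *)
Lemma full_sumset (X B : {fset int}) (L : {set R}) (r : nat) :
  full X -> (0 < r)%N -> L != set0 ->
  (forall l, l \in L -> (r <= #|` fiber phi B l|)%N) ->
  (#|` X| + #|R| * r.-1 + #|L| <= #|` dsum X B| + 1)%N.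
Proof.
move=> fullX r0 /set0Pn[l0 Ll0] rB.
have /fin_all_exists[m mP] : forall l, exists m : int, l \in L ->
    [/\ m \in B, phi m = l & forall x, x \in B -> phi x = l -> m <= x].
  move=> l; case: (boolP (l \in L)) => Ll; last by exists 0.
  have /fset_min[m] : fiber phi B l != fset0.
    by rewrite -cardfs_gt0; apply: leq_trans (rB _ Ll).
  rewrite in_fiber => /andP[Bm /eqP phim] minm; exists m => _; split=> // x Bx px.
  by apply: minm; rewrite in_fiber Bx px eqxx.
pose M := [fset m l | l in L].
have MP x : x \in M -> exists2 l, l \in L & x = m l.
  by move=> /imfsetP[/= l Ll ->]; exists l.
have Mm l : l \in L -> m l \in M by move=> Ll; apply/imfsetP; exists l.
have cM : #|` M| = #|L|.
  rewrite card_in_imfset /=; first by rewrite -cardE.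
  by move=> l l' Ll Ll' e; have [_ <- _] := mP _ Ll; have [_ <- _] := mP _ Ll'; rewrite e.
have X0 : X != fset0 by have [x Xx _] := fullX 0; apply/fset0Pn; exists x.
have M0 : M != fset0 by apply/fset0Pn; exists (m l0); apply: Mm.
set S := sumset _ B; pose S1 := dsum X M.
have base : (#|` X| + #|L| <= #|` S1| + 1)%N.
  rewrite -cM -(@card_dilate 2 X) //; apply: card_sumset_ge => //.
  by rewrite -cardfs_gt0 card_dilate // cardfs_gt0.
suff : (#|` S1| + #|R| * r.-1 <= #|` S|)%N by lia.
rewrite -(sum_card_fiber phi S1) -(sum_card_fiber phi S) -sum_nat_const -big_split /=.
apply: leq_sum => c _.
have S10 : fiber phi S1 c != fset0.
  have [x Xx px] := fullX (c - l0); apply/fset0Pn; exists (2 * x + m l0).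
  rewrite in_fiber phiD px; have [_ -> _] := mP _ Ll0; rewrite subrK eqxx andbT.
  by apply/dsumP; exists x, (m l0); split=> //; apply: Mm.
have [z zS1 maxz] := fset_max S10.
move: (zS1); rewrite in_fiber => /andP[/dsumP[x [y [Xx /MP[l Ll ->] ez]]] /eqP pz].
have [Bm pm minm] := mP _ Ll.
pose N := [fset 2 * x + b | b in fiber phi B l `\ m l].
have NP w : w \in N -> exists b, [/\ b \in B, phi b = l, b != m l & w = 2 * x + b].
  move=> /imfsetP[/= b]; rewrite !inE /= => /andP[bm /andP[Bb /eqP pb]] ->.
  by exists b.
apply: leq_trans (@leq_card_fsetU_disj (fiber phi S1 c) N _ _ _ _).
- have -> : #|` N| = #|` fiber phi B l `\ m l| := card_shift _ _.
  rewrite leq_add2l.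
  have := cardfsD1 (m l) (fiber phi B l); rewrite in_fiber Bm pm eqxx /=.
  by have := rB _ Ll; move=> /=; lia.
- apply/fsubsetP => w; rewrite !in_fiber => /andP[/dsumP[u [v [Xu /MP[l' Ll' ->] ->]]] ->].
  by rewrite andbT; apply/dsumP; exists u, (m l'); split=> //; have [] := mP _ Ll'.
- apply/fsubsetP => w /NP[b [Bb pb _ ->]]; rewrite in_fiber phiD pb.
  rewrite -pz ez phiD pm eqxx andbT.
  by apply/dsumP; exists x, b.
- move=> w wS1 /NP[b [Bb pb bm ew]]; have := maxz _ wS1; have := minm _ Bb pb.
  by rewrite ew ez lerD2l => lemb lebm; move: bm; rewrite eq_le lebm lemb.
Qed.

Lemma full_neq0 X : full X -> X != fset0.
Proof. by move=> /(_ 0)[x Xx _]; apply/fset0Pn; exists x. Qed.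

(** Each parity of A is one instance of [full_sumset], for a single class; if the
    class has no element of that parity, [dsum_ge] suffices. *)
Lemma full_dsum_ge X A l : full X -> mixed A ->
  (2 * #|` X| + #|R| * #|` fiber phi A l| <=
    #|` dsum X A| + 2 * #|R|)%N.
Proof.
move=> fX mA.
have half e : (#|` X| + #|R| * #|` fiber phi (fiber evenz A e) l| <=
    #|` dsum X (fiber evenz A e)| + #|R|)%N.
  set B := fiber evenz A e.
  have Bge := dsum_ge (full_neq0 fX) (mixed_fiber e mA).
  have B0 : (0 < #|` B|)%N by rewrite cardfs_gt0; apply: mixed_fiber.
  case: (posnP #|` fiber phi B l|) => [->|r0].
    by rewrite muln0 addn0; move: Bge B0; rewrite -/B; lia.
  have l0 : [set l] != set0 by apply/set0Pn; exists l; rewrite inE.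
  have := full_sumset fX r0 l0; rewrite cards1 => h.
  have {}/h : forall l', l' \in [set l] ->
      (#|` fiber phi B l| <= #|` fiber phi B l'|)%N by move=> l' /set1P ->.
  have -> : #|` fiber phi B l| = #|` fiber phi B l|.-1.+1 by rewrite prednK.
  by rewrite mulnS /=; lia.
have := half true; have := half false; have := dsum_parity X A.
have := card_parity (fiber phi A l); rewrite !(fiberC evenz); nia.
Qed.

(** Take r to be the size of the largest class of B and L the set of classes of
    that size in [full_sumset]. A class outside L makes |B| smaller than |J| r, and
    that saves |R| >= |J| in total over the family, at least as much as the
    |J| that one more class in L would have brought. *)
Lemma full_family_ge (J : {set R}) (X : R -> {fset int}) (B : {fset int}) :
  B != fset0 -> (forall b, b \in B -> phi b \in J) ->
  (forall i, i \in J -> full (X i)) ->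
  (\sum_(i in J) #|` X i| + #|R| * #|` B| + #|J| * #|J| <=
   \sum_(i in J) #|` dsum (X i) B| + #|R| * #|J| + #|J|)%N.
Proof.
move=> B0 BJ fX; pose c l := #|` fiber phi B l|.
have /fset0Pn[b Bb] := B0; have Jb := BJ _ Bb.
have [l1 Jl1 maxl1] : exists2 l1, l1 \in J & forall l, l \in J -> (c l <= c l1)%N.
  by case: (arg_maxnP c Jb) => l1 Jl1 h; exists l1.
have r0 : (0 < c l1)%N.
  apply: leq_trans (maxl1 _ Jb); rewrite cardfs_gt0; apply/fset0Pn.
  by exists b; rewrite in_fiber Bb eqxx.
pose L := [set l in J | c l == c l1].
have L0 : L != set0 by apply/set0Pn; exists l1; rewrite inE Jl1 eqxx.
have LJ : (#|L| <= #|J|)%N by apply/subset_leq_card/subsetP => l; rewrite inE => /andP[].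
have JR : (#|J| <= #|R|)%N by apply: max_card.
have cL l : l \in L -> (c l1 <= #|` fiber phi B l|)%N.
  by rewrite inE => /andP[_ /eqP <-].
have cB : (#|` B| + #|J| <= #|J| * c l1 + #|L|)%N.
  rewrite -(sum_card_fiber phi B) (bigID (mem J)) /= [X in (_ + X + _)%N]big1 ?addn0; last first.
    move=> l nJl; apply/eqP; rewrite cardfs_eq0; apply/eqP/fsetP => x.
    rewrite in_fiber inE; apply/negP => /andP[Bx /eqP px].
    by move: nJl; rewrite -px BJ.
  have -> : #|L| = (\sum_(l in J) (c l == c l1))%N.
    rewrite -sum1_card big_mkcond [RHS]big_mkcond; apply: eq_bigr => l _.
    by rewrite inE; case: (l \in J) => //=; case: eqP.
  rewrite -[X in (_ + X <= _)%N]sum1_card -sum_nat_const -!big_split /=.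
  apply: leq_sum => l Jl; have := maxl1 _ Jl.
  by rewrite -/(c l); case: (eqVneq (c l) (c l1)) => /=; lia.
have sum : (\sum_(i in J) #|` X i| + #|J| * (#|R| * (c l1).-1 + #|L|) <=
    \sum_(i in J) #|` dsum (X i) B| + #|J|)%N.
  rewrite -[X in (_ <= _ + X)%N]sum1_card -sum_nat_const -!big_split /=.
  by apply: leq_sum => i Ji; rewrite addnA; apply: full_sumset => //; apply: fX.
rewrite -[X in (_ <= _ * X + _)%N](prednK r0) in cB.
have arith (n j m d r x y : nat) : (j <= n -> m <= j ->
    x + j * (n * r + m) <= y + j -> d + j <= j * r.+1 + m ->
    x + n * d + j * j <= y + n * j + j)%N.
  move=> jn mj h1; rewrite mulnS => h2.
  have h3 : (n * d <= n * (j * r + m))%N by rewrite leq_mul2l; apply/orP; right; lia.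
  have : (j * (j - m) <= n * (j - m))%N by rewrite leq_mul2r jn orbT.
  move: h1 h3; rewrite !mulnBr !mulnDr (mulnCA n).
  have := leq_mul (leqnn j) mj; have := leq_mul (leqnn n) mj; lia.
exact: arith JR LJ sum cB.
Qed.

End Residues.

(** * Proper residue sets and their translates *)

Definition moved_by (R : finZmodType) (W : {set R}) (t : R) :=
  exists2 w, w \in W & w + t \notin W.

Definition stab (R : finZmodType) (W : {set R}) : pred R :=
  fun t => [forall w in W, w + t \in W].

Lemma stabPn (R : finZmodType) (W : {set R}) t : ~~ stab W t -> moved_by W t.
Proof. by case/forall_inPn => w; exists w. Qed.

Lemma stabD (R : finZmodType) (W : {set R}) t u : stab W t -> stab W u -> stab W (t + u).
Proof.
move=> /forall_inP st /forall_inP su; apply/forall_inP => w Ww.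
by rewrite addrA; apply: su; apply: st.
Qed.

Lemma stabMn (R : finZmodType) (W : {set R}) t n : stab W t -> stab W (t *+ n).
Proof.
move=> st; elim: n => [|n IH]; first by apply/forall_inP => w; rewrite mulr0n addr0.
by rewrite mulrS; apply: stabD.
Qed.

Lemma stab_all (R : finZmodType) (W : {set R}) :
  W != set0 -> (forall t, stab W t) -> W = setT.
Proof.
move=> /set0Pn[w Ww] st; apply/setP => c; rewrite inE.
by have /forall_inP/(_ _ Ww) := st (c - w); rewrite addrC subrK.
Qed.

Lemma Fp_multiple (p : nat) (c x : 'F_p) : c != 0 -> exists n, x = c *+ n.
Proof.
move=> c0; exists (x / c : 'F_p); rewrite -mulr_natr natr_Zp mulrC divfK //.
Qed.

(** The stabilizer of W is a subgroup of a group of prime order. *)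
Lemma Fp_moved p (W : {set 'F_p}) t : W != set0 -> W != setT -> t != 0 -> moved_by W t.
Proof.
move=> W0 WT t0; apply: stabPn; apply/negP => st; case/eqP: WT; apply: stab_all => // x.
by have [n ->] := Fp_multiple x t0; apply: stabMn.
Qed.

(** If the stabilizer contains t with nonzero first coordinate, then q t is a nonzero
    element of the first factor, because p differs from q, and generates that
    factor; likewise for the second coordinate. The stabilizer cannot contain both
    factors since W is proper. *)
Lemma FpFq_stab p q (W : {set 'F_p * 'F_q}) : prime p -> prime q -> p <> q ->
  W != set0 -> W != setT ->
  [\/ forall t, t != 0 -> moved_by W t,
      (forall w c, w \in W -> w + (c, 0) \in W) /\
        (forall t, t.2 != 0 -> moved_by W t) |
      (forall w c, w \in W -> w + (0, c) \in W) /\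
        (forall t, t.1 != 0 -> moved_by W t)].
Proof.
move=> pp pq pneq W0 WT.
have pneq' : q <> p by move=> e; apply: pneq.
have unit_pq (p' q' : nat) : prime p' -> prime q' -> p' <> q' -> (q'%:R : 'F_p') != 0.
  move=> pp' pq' ne; rewrite -(dvdn_pcharf (pchar_Fp pp')).
  by rewrite dvdn_prime2 //; apply/eqP.
have nq0 (x : 'F_q) : x *+ q = 0 by rewrite -mulr_natr pchar_Fp_0 // mulr0.
have np0 (x : 'F_p) : x *+ p = 0 by rewrite -mulr_natr pchar_Fp_0 // mulr0.
have pairMn (t : 'F_p * 'F_q) n : t *+ n = (t.1 *+ n, t.2 *+ n).
  by elim: n => [|n IH] //; rewrite !mulrS IH.
have stabP t c : stab W t -> t.1 != 0 -> stab W (c, 0).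
  move=> st t1; have h : t.1 *+ q != 0 by rewrite -mulr_natr mulf_neq0 // unit_pq.
  have [n ->] := Fp_multiple c h.
  suff -> : (t.1 *+ q *+ n, 0) = t *+ q *+ n by do 2!apply: stabMn.
  by rewrite !pairMn /= nq0 mul0rn.
have stabQ t c : stab W t -> t.2 != 0 -> stab W (0, c).
  move=> st t2; have h : t.2 *+ p != 0 by rewrite -mulr_natr mulf_neq0 // unit_pq.
  have [n ->] := Fp_multiple c h.
  suff -> : (0, t.2 *+ p *+ n) = t *+ p *+ n by do 2!apply: stabMn.
  by rewrite !pairMn /= np0 mul0rn.
case: (boolP [exists t, stab W t && (t.1 != 0)]) => [/existsP[t /andP[st t1]]|no1].
  constructor 2; split=> [w c Ww|u u2]; first by have /forall_inP := stabP _ c st t1; apply.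
  apply: stabPn; apply/negP => su; case/eqP: WT; apply: stab_all => // -[x y].
  have -> : (x, y) = (x, 0) + (0, y) by congr pair; rewrite ?addr0 ?add0r.
  by apply: stabD; [apply: stabP st t1|apply: stabQ su u2].
case: (boolP [exists t, stab W t && (t.2 != 0)]) => [/existsP[t /andP[st t2]]|no2].
  constructor 3; split=> [w c Ww|u u1]; first by have /forall_inP := stabQ _ c st t2; apply.
  apply: stabPn; apply/negP => su; case/negP: no1; apply/existsP; exists u.
  by rewrite su.
constructor 1 => t t0; apply: stabPn; apply/negP => st.
case/eqP: t0; case: t st => x y st; congr pair; apply/eqP/negPn/negP => ne.
  by case/negP: no1; apply/existsP; exists (x, y); rewrite st.
by case/negP: no2; apply/existsP; exists (x, y); rewrite st.
Qed.

Section Gain.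
Variables (R : finZmodType) (phi : int -> R).
Hypothesis phiD : {morph phi : x y / x + y}.

(** The elements of 2X + B' that fall in the residue classes S are new with respect
    to 2X + B. *)
Lemma gain_sumset (X A B B' : {fset int}) (r r' : R) (S : {set R}) :
  B `<=` A -> B' `<=` A ->
  (forall b, b \in B -> phi b = r) -> (forall b, b \in B' -> phi b = r') ->
  (forall s, s \in S -> exists2 x, x \in X & phi (2 * x) + r' = s) ->
  (forall s x, s \in S -> x \in X -> phi (2 * x) + r <> s) ->
  (#|` dsum X B| + #|S| * #|` B'| <= #|` dsum X A|)%N.
Proof.
move=> /fsubsetP BA /fsubsetP B'A pB pB' Sin Sout.
rewrite -(sum_card_fiber phi (sumset _ A)) -(sum_card_fiber phi (sumset _ B)).
rewrite -sum_nat_const [X in (_ + X)%N]big_mkcond -big_split /=.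
apply: leq_sum => c _; case: ifP => Sc.
  have -> : fiber phi (dsum X B) c = fset0.
    apply/fsetP => z; rewrite in_fiber inE; apply/negP => /andP[].
    move=> /dsumP[x [b [Xx Bb ->]]]; rewrite phiD (pB _ Bb) => /eqP.
    exact: Sout.
  have [x Xx px] := Sin _ Sc.
  rewrite cardfs0 add0n -(card_shift (2 * x) B').
  apply/fsubset_leq_card/fsubsetP => z /imfsetP[/= b Bb ->].
  rewrite in_fiber phiD (pB' _ Bb) px eqxx andbT; apply/dsumP; exists x, b.
  by split=> //; apply: B'A.
rewrite addn0; apply/fsubset_leq_card/fsubsetP => z; rewrite !in_fiber.
move=> /andP[/dsumP[x [b [Xx Bb ->]]] ->]; rewrite andbT.
by apply/dsumP; exists x, b; split=> //; apply: BA.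
Qed.

Definition residues2 (X : {fset int}) : {set R} :=
  [set c | [exists x : X, phi (2 * \val x) == c]].

Lemma residues2P X c : reflect (exists2 x, x \in X & phi (2 * x) = c) (c \in residues2 X).
Proof.
rewrite inE; apply: (iffP existsP) => [[x /eqP e]|[x Xx e]].
  by exists (\val x) => //; apply: valP.
by exists [` Xx]; apply/eqP.
Qed.

Lemma residues2_full X : residues2 X = setT -> full phi X.
Proof. by move=> WT c; apply/residues2P; rewrite WT inE. Qed.

Lemma residues2_neq0 X : X != fset0 -> residues2 X != set0.
Proof.
by case/fset0Pn => x Xx; apply/set0Pn; exists (phi (2 * x)); apply/residues2P; exists x.
Qed.

(** Each w in U yields the residue class w + l, which is met by 2X + A_l but not by
    2X + B. *)
Lemma gain_of_moved (X A B : {fset int}) (r l : R) (U : {set R}) :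
  B `<=` A -> (forall b, b \in B -> phi b = r) ->
  (forall w, w \in U -> w \in residues2 X /\ w + (l - r) \notin residues2 X) ->
  (#|` dsum X B| + #|U| * #|` fiber phi A l| <= #|` dsum X A|)%N.
Proof.
move=> BA Br UW; rewrite -(card_imset _ (addIr l)).
apply: (@gain_sumset X A B _ r l) => //.
- exact: fiber_sub.
- by move=> b; rewrite in_fiber => /andP[_ /eqP].
- move=> s /imsetP[w Uw ->]; have [/residues2P[x Xx px] _] := UW _ Uw.
  by exists x; rewrite ?px.
- move=> s x /imsetP[w Uw ->] Xx e; have [_ /negP[]] := UW _ Uw.
  by apply/residues2P; exists x => //; rewrite addrA -e addrK.
Qed.

Lemma gain_of_moved1 (X A B : {fset int}) (r l : R) :
  B `<=` A -> (forall b, b \in B -> phi b = r) ->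
  moved_by (residues2 X) (l - r) ->
  (#|` dsum X B| + #|` fiber phi A l| <= #|` dsum X A|)%N.
Proof.
move=> BA Br [w Ww wl]; have := @gain_of_moved X A B r l [set w] BA Br.
by rewrite cards1 mul1n; apply=> _ /set1P ->.
Qed.

End Gain.

Lemma Fp_gain p (phi : int -> 'F_p) (X A B : {fset int}) r l :
  {morph phi : x y / x + y} -> X != fset0 -> B `<=` A ->
  (forall b, b \in B -> phi b = r) -> l != r ->
  full phi X \/
  (#|` dsum X B| + #|` fiber phi A l| <= #|` dsum X A|)%N.
Proof.
move=> phiD X0 BA Br lr.
case: (eqVneq (residues2 phi X) setT) => [/residues2_full|WT]; first by left.
right; apply: gain_of_moved1 Br _ => //; apply: Fp_moved => //.
  exact: residues2_neq0.
by rewrite subr_eq0.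
Qed.

(** In the third case the residues of 2X are periodic under the first factor, so a
    new residue class brings the p classes of its coset with it. *)
Lemma FpFq_gain p q (phi : int -> 'F_p * 'F_q) (X A : {fset int}) i :
  prime p -> prime q -> p <> q ->
  {morph phi : x y / x + y} -> X != fset0 ->
  let gain l n := (#|` dsum X (fiber phi A i)| + n * #|` fiber phi A l| <=
      #|` dsum X A|)%N in
  [\/ full phi X,
      forall l, l != i -> gain l 1%N,
      forall l, l.2 != i.2 -> gain l p |
      forall l, l.1 != i.1 -> gain l q].
Proof.
move=> pp pq pneq phiD X0 gain; set W := residues2 phi X.
case: (eqVneq W setT) => [/residues2_full|WT]; first by constructor 1.
have Br b : b \in fiber phi A i -> phi b = i by rewrite in_fiber => /andP[_ /eqP].
have BA := fiber_sub phi A i.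
case: (FpFq_stab pp pq pneq (residues2_neq0 phi X0) WT) => [st|[per st]|[per st]].
- constructor 2 => l li; rewrite /gain mul1n; apply: gain_of_moved1 Br _ => //.
  by apply: st; rewrite subr_eq0.
- constructor 3 => l li; have /st[w Ww wl] : (l - i).2 != 0 by rewrite subr_eq0.
  pose U := [set w + (c, 0 : 'F_q) | c in [set: 'F_p]].
  have cU : #|U| = p by rewrite card_imset ?cardsT ?card_Fp // => c d /addrI[].
  have := @gain_of_moved _ phi phiD X A (fiber phi A i) i l U BA Br.
  rewrite cU; apply=> _ /imsetP[c _ ->].
  split; first exact: per.
  apply/negP => /(per _ (- c)); rewrite addrAC -(addrA w).
  have -> : (c, 0) + (- c, 0) = 0 :> 'F_p * 'F_q by congr pair; rewrite ?subrr ?addr0.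
  by rewrite addr0; apply/negP.
- constructor 4 => l li; have /st[w Ww wl] : (l - i).1 != 0 by rewrite subr_eq0.
  pose U := [set w + (0 : 'F_p, c) | c in [set: 'F_q]].
  have cU : #|U| = q by rewrite card_imset ?cardsT ?card_Fp // => c d /addrI[].
  have := @gain_of_moved _ phi phiD X A (fiber phi A i) i l U BA Br.
  rewrite cU; apply=> _ /imsetP[c _ ->].
  split; first exact: per.
  apply/negP => /(per _ (- c)); rewrite addrAC -(addrA w).
  have -> : (0, c) + (0, - c) = 0 :> 'F_p * 'F_q by congr pair; rewrite ?subrr ?addr0.
  by rewrite addr0; apply/negP.
Qed.

(** * Affine images *)

Definition affine (d u : int) (X : {fset int}) := [fset d * x + u | x in X].

Lemma affineP d u X z : reflect (exists2 x, x \in X & z = d * x + u) (z \in affine d u X).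
Proof. by apply: (iffP (imfsetP _ _ _ _)) => -[a Aa ->]; exists a. Qed.

Lemma card_affine d u X : d != 0 -> #|` affine d u X| = #|` X|.
Proof. by move=> d0; apply: card_imfset => x y /addIr /(mulfI d0). Qed.

Lemma card_dsum_affine d u w X C : d != 0 ->
  #|` sumset (dilate 2 (affine d u X)) (affine d w C)| = #|` dsum X C|.
Proof.
move=> d0; rewrite -(card_affine (2 * u + w) (dsum X C) d0).
congr (size (enum_fset _)); apply/fsetP => z; apply/dsumP/affineP.
  move=> [_ [_ [/affineP[x Xx ->] /affineP[c Cc ->] ->]]].
  exists (2 * x + c); first by apply/dsumP; exists x, c.
  by ring.
move=> [_ /dsumP[x [c [Xx Cc ->]]] ->]; exists (d * x + u), (d * c + w); split.
- by apply/affineP; exists x.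
- by apply/affineP; exists c.
- by ring.
Qed.

Lemma dilate_affine k d u X : dilate k (affine d u X) = affine d (k * u) (dilate k X).
Proof.
apply/fsetP => z; apply/dilateP/affineP.
  move=> [_ /affineP[x Xx ->] ->]; exists (k * x); last by ring.
  by apply/dilateP; exists x.
move=> [_ /dilateP[x Xx ->] ->]; exists (d * x + u); last by ring.
by apply/affineP; exists x.
Qed.

Lemma dilateE k A : dilate k A = affine k 0 A.
Proof.
by apply/fsetP => z; apply/dilateP/affineP => -[x Xx ->]; exists x => //; rewrite addr0.
Qed.

Lemma divisible_fiber k (B : {fset int}) : k != 0 ->
  (forall x y, x \in B -> y \in B -> (k %| x - y)%Z) ->
  exists u X, B = affine k u X.
Proof.
move=> k0 Bk; case: (eqVneq B fset0) => [->|/fset0Pn[u Bu]].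
  by exists 0, fset0; apply/fsetP => z; apply/idP/idP => [|/affineP[x]]; rewrite in_fset0.
exists u, [fset ((x - u) %/ k)%Z | x in B].
have div x : x \in B -> x = k * ((x - u) %/ k)%Z + u.
  by move=> Bx; rewrite mulrC divzK ?subrK //; apply: Bk.
apply/fsetP => z; apply/idP/affineP => [Bz|[_ /imfsetP[/= x Bx ->] ->]].
  by exists ((z - u) %/ k)%Z; [apply/imfsetP; exists z|apply: div].
by rewrite -div.
Qed.

Lemma seq_gcd (s : seq int) : exists d : int,
  (forall x, x \in s -> (d %| x)%Z) /\
  (forall m, (forall x, x \in s -> (m %| x)%Z) -> (m %| d)%Z).
Proof.
elim: s => [|y s [d [ds dmax]]]; first by exists 0; split=> // m _; apply: dvdz0.
exists (gcdz y d); split=> [x|m ms].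
  rewrite inE => /orP[/eqP->|/ds]; first exact: dvdz_gcdl.
  by apply: dvdz_trans; apply: dvdz_gcdr.
rewrite dvdz_gcd ms ?mem_head //=; apply: dmax => x sx.
by apply: ms; rewrite inE sx orbT.
Qed.

Definition reduced (A : {fset int}) :=
  forall m : int, (forall x y, x \in A -> y \in A -> (m %| x - y)%Z) -> `|m|%N = 1%N.

(** Divide the differences with a fixed element by their gcd. *)
Lemma exists_reduced k (S : {fset int}) : (1 < #|` S|)%N ->
  exists A, [/\ reduced A, #|` A| = #|` S| &
    #|` sumset (dilate 2 A) (dilate k A)| = #|` sumset (dilate 2 S) (dilate k S)|].
Proof.
move=> S1; have /fset0Pn[a Sa] : S != fset0 by rewrite -cardfs_gt0; lia.
have [b Sb ba] : exists2 b, b \in S & b != a.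
  have := cardfsD1 a S; rewrite Sa => cS.
  have /fset0Pn[b] : S `\ a != fset0 by rewrite -cardfs_gt0; move: S1 cS; lia.
  by rewrite !inE => /andP[ba Sb]; exists b.
have [d [dS dmax]] := seq_gcd [seq x - a | x <- S].
have dSa x : x \in S -> (d %| x - a)%Z by move=> Sx; apply: dS; apply: map_f.
have d0 : d != 0.
  by apply/eqP => d0; have := dSa _ Sb; rewrite d0 dvd0z subr_eq0 (negPf ba).
pose A := [fset ((x - a) %/ d)%Z | x in S].
have SA : S = affine d a A.
  have div x : x \in S -> x = d * ((x - a) %/ d)%Z + a.
    by move=> Sx; rewrite mulrC divzK ?subrK //; apply: dSa.
  apply/fsetP => z; apply/idP/affineP => [Sz|[_ /imfsetP[/= x Sx ->] ->]].
    by exists ((z - a) %/ d)%Z; [apply/imfsetP; exists z|apply: div].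
  by rewrite -div.
exists A; split.
- move=> m mA; have /dvdzP[q dq] : (m * d %| d)%Z.
    apply: dmax => _ /mapP[x Sx ->].
    have Aa : 0 \in A by apply/imfsetP; exists a => //; rewrite subrr div0z.
    have Ax : ((x - a) %/ d)%Z \in A by apply/imfsetP; exists x.
    by have := mA _ _ Ax Aa; rewrite subr0 -{2}(divzK (dSa _ Sx)) dvdz_mul2r.
  have : (m %| 1)%Z; last by rewrite dvdz1 => /eqP.
  by apply/dvdzP; exists q; apply: (mulIf d0); rewrite mul1r -mulrA -dq.
- by rewrite SA card_affine.
- by rewrite SA [dilate k (affine _ _ _)]dilate_affine card_dsum_affine.
Qed.

Lemma reduced_neq A (m a : int) : reduced A -> `|m|%N != 1%N ->
  exists2 b, b \in A & ~~ (m %| b - a)%Z.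
Proof.
move=> rA m1; case: (boolP [exists b : A, ~~ (m %| \val b - a)%Z]) => [/existsP[b h]|].
  by exists (\val b) => //; apply: valP.
rewrite negb_exists => /forallP h; case/eqP: m1; apply: rA => x y Ax Ay.
have := h [` Ax]; have := h [` Ay]; rewrite !negbK /= => hy hx.
have -> : x - y = (x - a) - (y - a) by ring.
by rewrite rpredB.
Qed.

Lemma reduced_mixed A : reduced A -> mixed A.
Proof.
move=> rA [].
  have [b Ab h] := @reduced_neq A 2 1 rA isT; exists b => //; move: h.
  by rewrite /evenz; lia.
by have [b Ab h] := @reduced_neq A 2 0 rA isT; exists b => //; move: h; rewrite /evenz; lia.
Qed.

(** The class of index i is k X i + u i. The sums 2 (k x + u i) + k a have residue
    i + i, so different classes contribute disjoint parts of 2A + kA, and each part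
    is an affine image of 2 (X i) + A. *)
Lemma fiber_decomposition (R : finZmodType) (phi : int -> R) (k : int) (A : {fset int}) :
  {morph phi : x y / x + y} -> injective (fun c : R => c + c) ->
  k != 0 -> (forall a, phi (k * a) = 0) ->
  (forall x y, phi x = phi y -> (k %| x - y)%Z) ->
  exists X : R -> {fset int}, [/\
    forall i, #|` X i| = #|` fiber phi A i|,
    (\sum_i #|` dsum (X i) A| <=
      #|` sumset (dilate 2 A) (dilate k A)|)%N &
    forall i, #|` sumset (dilate 2 (fiber phi A i)) (dilate k (fiber phi A i))| =
      #|` dsum (X i) (fiber phi A i)|].
Proof.
move=> phiD dbl k0 phik phik'.
have /fin_all_exists[u /fin_all_exists[X AX]] :
    forall i, exists u X, fiber phi A i = affine k u X.
  move=> i; apply: divisible_fiber => // x y; rewrite !in_fiber.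
  by move=> /andP[_ /eqP px] /andP[_ /eqP py]; apply: phik'; rewrite px.
exists X; split.
- by move=> i; rewrite AX card_affine.
- pose F i := sumset (dilate 2 (fiber phi A i)) (dilate k A).
  have <- : (\sum_i #|` F i| = \sum_i #|` dsum (X i) A|)%N.
    by apply: eq_bigr => j _; rewrite /F AX [dilate k _]dilateE card_dsum_affine.
  apply: (leq_sum_card_fibers (phi := phi) dbl) => j z.
  move=> /dsumP[x [_ [xA /dilateP[a Aa ->] ->]]].
  move: xA; rewrite in_fiber => /andP[Ax /eqP <-]; split.
    by apply/dsumP; exists x, (k * a); split=> //; apply/dilateP; exists a.
  by rewrite phiD phik addr0 mulrDl mul1r phiD.
- by move=> i; rewrite AX [dilate k _]dilateE card_dsum_affine.
Qed.

(** * Adding up the gains of the classes *)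

(** Here a i is the size of the class i, g i its gain, s i its column, b the size
    of the column of l1, and i1 is a class of that column with a gain below a l1. As
    p (a i0) is at most g i1, hence below b, the inequality m + 1 <= p q makes the
    gains of i0 and i1 together pay for i0 and for the whole column of l1. *)
Lemma column_gain (I : finType) (S : eqType) (s : I -> S) (J : {set I})
    (a g : I -> int) (p q m : int) (l1 i1 i0 : I) :
  1 <= p -> 1 <= q -> 0 <= m -> m + 1 <= p * q ->
  (forall i, i \in J -> 0 <= a i) -> (forall i, i \in J -> 0 <= g i) ->
  l1 \in J -> i1 \in J -> i0 \in J ->
  s i1 = s l1 -> s i0 <> s l1 -> g i1 < a l1 -> p * a i0 <= g i1 ->
  (forall l, l \in J -> s l <> s l1 -> l <> i0 -> a l <= g l) ->
  let b := \sum_(l in J | s l == s l1) a l in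
  b <= g i0 \/ q * b - m * a i0 <= g i0 ->
  \sum_(i in J) a i <= \sum_(i in J) g i.
Proof.
move=> p1 q1 m0 mpq a0 g0 Jl1 Ji1 Ji0 si1 si0 gi1 pai0 rest b bg.
rewrite (bigID (fun l => s l == s l1)) /= [X in _ <= X](bigID (fun l => s l == s l1)) /=.
rewrite -/b (bigD1 (P := fun i => (i \in J) && (s i != s l1)) i0) /=; last first.
  by rewrite Ji0; apply/eqP.
rewrite [X in _ <= _ + X](bigD1 i0) /=; last by rewrite Ji0; apply/eqP.
have le1 : g i1 <= \sum_(i in J | s i == s l1) g i.
  rewrite (bigD1 i1) /=; last by rewrite Ji1 si1 eqxx.
  by rewrite lerDl sumr_ge0 // => i /andP[/andP[Ji _] _]; apply: g0.
have le2 : \sum_(i | (i \in J) && (s i != s l1) && (i != i0)) a i <=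
           \sum_(i | (i \in J) && (s i != s l1) && (i != i0)) g i.
  by apply: ler_sum => i /andP[/andP[Ji /eqP si] /eqP ii0]; apply: rest.
have bl1 : a l1 <= b.
  rewrite /b (bigD1 l1) /=; last by rewrite Jl1 eqxx.
  by rewrite lerDl sumr_ge0 // => i /andP[/andP[Ji _] _]; apply: a0.
suff : b + a i0 <= g i1 + g i0 by lra.
have := a0 _ Ji0; case: bg => bg ai0; first by nia.
nia.
Qed.

(** Let l1 be the largest class. If every other class gains at least a l1, then l1
    only has to gain the size of one other class, and it does. Otherwise some class
    with a smaller gain lies in the column or in the row of l1, and [column_gain]
    applies to that line unless some class outside the line gains less than its own
    size. Such a class lies in the other line through l1, and its small gain forces
    the remaining classes outside that other line to be small, so that [column_gain]
    applies to the other line. *)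
Lemma total_gain (I : finType) (R S : eqType) (r : I -> R) (s : I -> S)
    (J : {set I}) (a g : I -> int) (p q m : int) :
  1 <= p -> 1 <= q -> 0 <= m -> m + 1 <= p * q ->
  J != set0 ->
  (forall i, i \in J -> 0 <= a i) ->
  (forall i, i \in J -> exists2 l, l \in J & r l <> r i) ->
  (forall i, i \in J -> exists2 l, l \in J & s l <> s i) ->
  (forall i, i \in J ->
    [\/ forall l, l \in J -> p * q * a l - m * a i <= g i,
        forall l, l \in J -> l <> i -> a l <= g i,
        forall l, l \in J -> s l <> s i -> p * a l <= g i |
        forall l, l \in J -> r l <> r i -> q * a l <= g i]) ->
  (forall i l, i \in J -> l \in J -> s l <> s i ->
    let b := \sum_(l' in J | s l' == s l) a l' in
    b <= g i \/ q * b - m * a i <= g i) ->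
  (forall i l, i \in J -> l \in J -> r l <> r i ->
    let b := \sum_(l' in J | r l' == r l) a l' in
    b <= g i \/ p * b - m * a i <= g i) ->
  \sum_(i in J) a i <= \sum_(i in J) g i.
Proof.
move=> p1 q1 m0 mpq J0 a0 rJ sJ types colgain rowgain.
have g0 i : i \in J -> 0 <= g i.
  move=> Ji; have ai := a0 _ Ji; have [lr Jlr nr] := rJ _ Ji.
  have [ls Jls ns] := sJ _ Ji.
  case: (types _ Ji) => gi.
  - by have := gi _ Ji; nia.
  - by apply: le_trans (a0 _ Jlr) (gi _ Jlr _) => e; apply: nr; rewrite e.
  - by have := gi _ Jls ns; have := a0 _ Jls; nia.
  - by have := gi _ Jlr nr; have := a0 _ Jlr; nia.
have [l1 Jl1 maxl1] : exists2 l1, l1 \in J & forall l, l \in J -> a l <= a l1.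
  by case/set0Pn: J0 => x Jx; case: (arg_maxP a Jx) => l1 Jl1 h; exists l1.
case: (boolP [forall i in J, (i != l1) ==> (a l1 <= g i)]) => [/forall_inP good|].
  have good' i : i \in J -> i != l1 -> a l1 <= g i.
    by move=> Ji il1; move: (good _ Ji); rewrite il1.
  have [i0 Ji0 [i01 gl1]] : exists2 i0, i0 \in J & i0 <> l1 /\ a i0 <= g l1.
    have [lr Jlr nr] := rJ _ Jl1; have [ls Jls ns] := sJ _ Jl1.
    have rl1 : lr <> l1 by move=> e; apply: nr; rewrite e.
    have sl1 : ls <> l1 by move=> e; apply: ns; rewrite e.
    case: (types _ Jl1) => gi.
    - by exists lr => //; split=> //; have := gi _ Jl1; have := maxl1 _ Jlr; have := a0 _ Jlr; nia.
    - by exists lr => //; split=> //; apply: gi.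
    - by exists ls => //; split=> //; have := gi _ Jls ns; have := a0 _ Jls; nia.
    - by exists lr => //; split=> //; have := gi _ Jlr nr; have := a0 _ Jlr; nia.
  have i01b : (i0 \in J) && (i0 != l1) by rewrite Ji0; apply/eqP.
  rewrite (bigD1 l1) // (bigD1 i0) //= [X in _ <= X](bigD1 l1) // [X in _ <= _ + X](bigD1 i0) //=.
  have : \sum_(i | (i \in J) && (i != l1) && (i != i0)) a i <=
         \sum_(i | (i \in J) && (i != l1) && (i != i0)) g i.
    apply: ler_sum => i /andP[/andP[Ji il1] _].
    exact: le_trans (maxl1 _ Ji) (good' _ Ji il1).
  have := good' _ Ji0 (introN eqP i01); lra.
(* A class of the first two types gains at least a l1, and so does a class of the
   last two types whose column, respectively row, is not that of l1. *)
have bad i : i \in J -> i <> l1 -> g i < a l1 ->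
    (s i = s l1 /\ forall l, l \in J -> s l <> s l1 -> p * a l <= g i) \/
    (r i = r l1 /\ forall l, l \in J -> r l <> r l1 -> q * a l <= g i).
  move=> Ji il1 gi; case: (types _ Ji) => ti.
  - by have := ti _ Jl1; have := maxl1 _ Ji; have := a0 _ Ji; nia.
  - by have := ti _ Jl1 (nesym il1); rewrite leNgt gi.
  - case: (eqVneq (s i) (s l1)) => [e|/eqP/nesym ne]; last first.
      by have := ti _ Jl1 ne; have := a0 _ Jl1; nia.
    by left; split=> // l Jl; rewrite -e; apply: ti.
  - case: (eqVneq (r i) (r l1)) => [e|/eqP/nesym ne]; last first.
      by have := ti _ Jl1 ne; have := a0 _ Jl1; nia.
    by right; split=> // l Jl; rewrite -e; apply: ti.
have mqp : m + 1 <= q * p by rewrite mulrC.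
have argP i1 : i1 \in J -> i1 <> l1 -> g i1 < a l1 -> s i1 = s l1 ->
    (forall l, l \in J -> s l <> s l1 -> p * a l <= g i1) ->
    (forall l, l \in J -> s l <> s l1 -> a l <= g l) ->
    \sum_(i in J) a i <= \sum_(i in J) g i.
  move=> Ji1 i1l1 gi1 si1 pg rest; have [i0 Ji0 si0] := sJ _ Jl1.
  apply: (@column_gain _ _ s J a g p q m l1 i1 i0) => //; first exact: pg.
    by move=> l Jl sl _; apply: rest.
  exact: colgain Ji0 Jl1 (nesym si0).
have argQ i1 : i1 \in J -> i1 <> l1 -> g i1 < a l1 -> r i1 = r l1 ->
    (forall l, l \in J -> r l <> r l1 -> q * a l <= g i1) ->
    (forall l, l \in J -> r l <> r l1 -> a l <= g l) ->
    \sum_(i in J) a i <= \sum_(i in J) g i.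
  move=> Ji1 i1l1 gi1 si1 pg rest; have [i0 Ji0 si0] := rJ _ Jl1.
  apply: (@column_gain _ _ r J a g q p m l1 i1 i0) => //; first exact: pg.
    by move=> l Jl sl _; apply: rest.
  exact: rowgain Ji0 Jl1 (nesym si0).
case/forall_inPn => i1 Ji1; rewrite negb_imply -ltNge => /andP[/eqP i1l1 gi1].
case: (bad _ Ji1 i1l1 gi1) => -[e1 big1].
  case: (boolP [forall l in J, (s l != s l1) ==> (a l <= g l)]) => [/forall_inP h|].
    by apply: (argP i1) => // l Jl /eqP sl; move: (h _ Jl); rewrite sl.
  case/forall_inPn => l Jl; rewrite negb_imply -ltNge => /andP[/eqP sl gl].
  have ll1 : l <> l1 by move=> e; apply: sl; rewrite e.
  have gl' : g l < a l1 by apply: lt_le_trans gl (maxl1 _ Jl).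
  case: (bad _ Jl ll1 gl') => -[el bigl]; first by case: sl.
  apply: (argQ l) => // i Ji ri; rewrite leNgt; apply/negP => gi.
  have il1 : i <> l1 by move=> e; apply: ri; rewrite e.
  case: (bad _ Ji il1 (lt_le_trans gi (maxl1 _ Ji))) => -[e bigi]; last by case: ri.
  by have := bigi _ Jl sl; have := bigl _ Ji ri; have := a0 _ Jl; have := a0 _ Ji; nia.
case: (boolP [forall l in J, (r l != r l1) ==> (a l <= g l)]) => [/forall_inP h|].
  by apply: (argQ i1) => // l Jl /eqP sl; move: (h _ Jl); rewrite sl.
case/forall_inPn => l Jl; rewrite negb_imply -ltNge => /andP[/eqP sl gl].
have ll1 : l <> l1 by move=> e; apply: sl; rewrite e.
have gl' : g l < a l1 by apply: lt_le_trans gl (maxl1 _ Jl).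
case: (bad _ Jl ll1 gl') => -[el bigl]; last by case: sl.
apply: (argP l) => // i Ji ri; rewrite leNgt; apply/negP => gi.
have il1 : i <> l1 by move=> e; apply: ri; rewrite e.
case: (bad _ Ji il1 (lt_le_trans gi (maxl1 _ Ji))) => -[e bigi]; first by case: ri.
by have := bigi _ Jl sl; have := bigl _ Ji ri; have := a0 _ Jl; have := a0 _ Ji; nia.
Qed.

(** * Residues modulo a product of two odd primes *)

Section TwoPrimes.
Variables (p q : nat).
Hypotheses (pp : prime p) (pq : prime q) (p_odd : odd p) (q_odd : odd q) (pneq : p <> q).

Local Notation k := (p * q)%N.
Local Notation R := ('F_p * 'F_q)%type.

Definition residue (a : int) : R := (a%:~R, a%:~R).

Definition dilates_card (A : {fset int}) : nat := #|` sumset (dilate 2 A) (dilate k%:Z A)|.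

Lemma intr_eq0_Fp r (pr : prime r) (a : int) : ((a%:~R : 'F_r) == 0) = (r%:Z %| a)%Z.
Proof. by rewrite (dvdz_pcharf (pchar_Fp pr)). Qed.

Lemma residueD : {morph residue : x y / x + y}.
Proof. by move=> x y; rewrite /residue !rmorphD. Qed.

Lemma residue_mulk a : residue (k%:Z * a) = 0.
Proof.
congr pair; apply/eqP; rewrite intr_eq0_Fp //.
  by rewrite PoszM -mulrA dvdz_mulr.
by rewrite PoszM -mulrA mulrCA dvdz_mulr.
Qed.

Lemma residue_eq x y : residue x = residue y -> (k%:Z %| x - y)%Z.
Proof.
case=> /eqP e1 /eqP e2; rewrite dvdzE absz_nat Gauss_dvd; last first.
  by rewrite prime_coprime // dvdn_prime2 //; apply/eqP.
by rewrite -[p]absz_nat -[q]absz_nat -!dvdzE -!intr_eq0_Fp // !rmorphB !subr_eq0 e1.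
Qed.

Lemma Fp_double r : prime r -> odd r -> injective (fun c : 'F_r => c + c).
Proof.
move=> pr or c d /eqP; rewrite -!mulr2n -subr_eq0 -mulrnBl -mulr_natr mulf_eq0.
have /negPf -> : (2%:R : 'F_r) != 0.
  rewrite -(dvdn_pcharf (pchar_Fp pr)) dvdn_prime2 //.
  by apply: contraTneq or => ->.
by rewrite orbF subr_eq0 => /eqP.
Qed.

Lemma residue_double : injective (fun c : R => c + c).
Proof.
move=> [a b] [c d] e; congr pair.
  by apply: (Fp_double pp p_odd); apply: (congr1 fst e).
by apply: (Fp_double pq q_odd); apply: (congr1 snd e).
Qed.

Lemma card_residue : #|{: R}| = k.
Proof. by rewrite card_prod !card_Fp. Qed.

Lemma pq_ge15 : (15 <= k)%N.
Proof.
have p1 := prime_gt1 pp; have q1 := prime_gt1 pq.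
have : (3 <= p)%N && (5 <= q)%N || (5 <= p)%N && (3 <= q)%N by lia.
by case/orP => /andP[h1 h2]; have := leq_mul h1 h2.
Qed.

Definition hit (A : {fset int}) : {set R} := [set i | fiber residue A i != fset0].

Lemma sum_hit (F : R -> nat) (A : {fset int}) : (\sum_(i in hit A) F i <= \sum_i F i)%N.
Proof. by rewrite big_mkcond; apply: leq_sum => i _; case: ifP. Qed.

Lemma sum_card_hit A : (\sum_(i in hit A) #|` fiber residue A i| = #|` A|)%N.
Proof.
rewrite -[RHS](sum_card_fiber residue A) [RHS](bigID (mem (hit A))) /=.
rewrite [X in (_ + X)%N]big1 ?addn0 // => i; rewrite inE negbK => /eqP ->.
exact: cardfs0.
Qed.

Lemma mem_hit A a : a \in A -> residue a \in hit A.
Proof.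
by move=> Aa; rewrite inE; apply/fset0Pn; exists a; rewrite in_fiber Aa eqxx.
Qed.

Lemma hit_fst A (i : R) : reduced A -> exists2 l, l \in hit A & l.1 <> i.1.
Proof.
move=> rA; have p1 : `|p%:Z|%N != 1%N by rewrite absz_nat; have := prime_gt1 pp; lia.
have [b Ab nb] := @reduced_neq A p (i.1 : nat)%:Z rA p1.
exists (residue b); first exact: mem_hit.
move=> /= e; case/negP: nb.
by rewrite -intr_eq0_Fp // rmorphB /= e -[X in X - _]natr_Zp subrr.
Qed.

Lemma hit_snd A (i : R) : reduced A -> exists2 l, l \in hit A & l.2 <> i.2.
Proof.
move=> rA; have q1 : `|q%:Z|%N != 1%N by rewrite absz_nat; have := prime_gt1 pq; lia.
have [b Ab nb] := @reduced_neq A q (i.2 : nat)%:Z rA q1.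
exists (residue b); first exact: mem_hit.
move=> /= e; case/negP: nb.
by rewrite -intr_eq0_Fp // rmorphB /= e -[X in X - _]natr_Zp subrr.
Qed.

(** The classes modulo k are grouped here into lines, the classes modulo r, where r
    is p or q. If X is not full modulo r, a new class modulo r of 2X + A contains a
    translate of the line of l; if X is full, every class modulo r of 2X + A does. *)
Lemma line_gain r (pi : R -> 'F_r) (A X : {fset int}) (i l : R) (m C : nat) :
  prime r -> (r <= k)%N -> {morph pi : x y / x + y} ->
  mixed A -> X != fset0 -> #|` X| = #|` fiber residue A i| ->
  pi l <> pi i -> (2 * k <= C)%N ->
  (m.+2 * #|` fiber residue A i| <= #|` dsum X (fiber residue A i)| + C)%N ->
  let b := (\sum_(l' in hit A | pi l' == pi l) #|` fiber residue A l'|)%N in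
  let t := #|` dsum X A| in
  (b + m.+2 * #|` X| <= t + C)%N \/ (r * b + 2 * #|` X| <= t + C)%N.
Proof.
move=> pr rk piD mA X0 cX li kC IH b t; pose psi x := pi (residue x).
have psiD : {morph psi : x y / x + y} by move=> x y; rewrite /psi residueD piD.
have bA : (b <= #|` fiber psi A (pi l)|)%N.
  rewrite -(sum_card_fiber residue (fiber psi A (pi l))) /b big_mkcond /=.
  apply: leq_sum => l' _; case: ifP => // /andP[_ /eqP e].
  apply/fsubset_leq_card/fsubsetP => x; rewrite !in_fiber => /andP[-> /eqP rx] /=.
  by rewrite /psi rx e !eqxx.
have Br x : x \in fiber residue A i -> psi x = pi i.
  by rewrite in_fiber /psi => /andP[_ /eqP <-].
have [fX|gX] := Fp_gain (l := pi l) psiD X0 (fiber_sub residue A i) Br (introN eqP li).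
  right; have := full_dsum_ge psiD (pi l) fX mA; rewrite card_Fp //.
  move: bA; rewrite -/t; move: #|` fiber psi A (pi l)| => n bn h.
  have : (r * b <= r * n)%N by rewrite leq_mul2l bn orbT.
  move: h; lia.
left; rewrite cX; move: gX bA; rewrite -/t; move: #|` fiber psi A (pi l)| => n.
lia.
Qed.

Lemma hit_decomposition A : exists X : R -> {fset int}, [/\
    forall i, #|` X i| = #|` fiber residue A i|,
    (\sum_(i in hit A) #|` dsum (X i) A| <= dilates_card A)%N,
    forall i, dilates_card (fiber residue A i) = #|` dsum (X i) (fiber residue A i)| &
    forall i, i \in hit A -> X i != fset0].
Proof.
have k0 : k%:Z != 0 by have := pq_ge15; lia.
have [X [cX sX wX]] :=
  fiber_decomposition A residueD residue_double k0 residue_mulk residue_eq.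
exists X; split=> //; first exact: leq_trans (sum_hit _ _) sX.
by move=> i; rewrite inE -!cardfs_gt0 cX.
Qed.

(** * A weaker bound for all sets *)

Definition weak_bound m C :=
  forall S, S != fset0 -> (m.+2 * #|` S| <= dilates_card S + C)%N.

Lemma dilates_card_gt0 S : S != fset0 -> (0 < dilates_card S)%N.
Proof.
case/fset0Pn => a Sa; rewrite cardfs_gt0; apply/fset0Pn; exists (2 * a + k%:Z * a).
by apply/dsumP; exists a, (k%:Z * a); split=> //; apply/dilateP; exists a.
Qed.

Lemma weak_reduce m C :
  (m.+2 <= C.+1)%N ->
  (forall A, reduced A -> (1 < #|` A|)%N -> (m.+2 * #|` A| <= dilates_card A + C)%N) ->
  weak_bound m C.
Proof.
move=> mC H S S0; case: (ltnP 1 #|` S|) => [S1|S1].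
  by have [A [rA cA wA]] := exists_reduced k%:Z S1; rewrite -cA /dilates_card -wA; apply: H; rewrite ?cA.
have := dilates_card_gt0 S0; move: S1; rewrite -[S != fset0]cardfs_gt0 in S0.
by move: S0; case: #|` S| => [|[|]] //; rewrite muln1; lia.
Qed.

(** Every class contributes at least 2|X_i| + |A| - 2. *)
Lemma many_classes A : reduced A -> (0 < #|` A|)%N ->
  (2 * #|` A| + #|hit A| * #|` A| <= dilates_card A + 2 * #|hit A|)%N.
Proof.
move=> rA A0; have [X [cX sX _ X0]] := hit_decomposition A.
apply: (@leq_trans (\sum_(i in hit A) #|` dsum (X i) A| + 2 * #|hit A|)%N);
  last by rewrite leq_add2r.
rewrite -{1}(sum_card_hit A) big_distrr /= -sum_nat_const mulnC -sum_nat_const -!big_split /=.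
by apply: leq_sum => i Ji; rewrite -cX; apply: mixed_dsum_ge (X0 _ Ji) (reduced_mixed rA).
Qed.

(** With more than m classes, [many_classes] has slope at least m + 3. With at most m
    classes the constant C is lost at most m times, and the gains of the classes
    over the slope m + 2 add up to |A| by [total_gain]. *)
Lemma weak_bound_step m C : (m < k)%N -> (2 * k <= C)%N ->
  weak_bound m C -> weak_bound m.+1 (k * C).
Proof.
move=> mk kC IH; have k15 := pq_ge15.
have CkC : (2 * k <= k * C)%N by nia.
apply: weak_reduce => [|A rA A1]; first by lia.
case: (leqP #|hit A| m) => [jm|mj]; last first.
  have := many_classes rA (ltnW A1); rewrite -(subnKC mj); move: (_ - _)%N => d.
  have : (d * 2 <= d * #|` A|)%N by rewrite leq_mul2l A1 orbT.
  have : (k * 2 <= k * C)%N by rewrite leq_mul2l; apply/orP; right; lia.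
  by rewrite mulnDl !mulSn; lia.
have mA := reduced_mixed rA.
have [X [cX sX wX X0]] := hit_decomposition A.
pose a i := #|` fiber residue A i|; pose t i := #|` dsum (X i) A|.
have IHi i : i \in hit A ->
    (m.+2 * a i <= #|` dsum (X i) (fiber residue A i)| + C)%N.
  by move=> Ji; rewrite -wX; apply: IH; move: Ji; rewrite inE.
have pk : (p <= k)%N by rewrite leq_pmulr // prime_gt0.
have qk : (q <= k)%N by rewrite leq_pmull // prime_gt0.
pose g i : int := (t i)%:Z + C%:Z - (m.+2 * a i)%:Z.
have := @total_gain R 'F_p 'F_q fst snd (hit A) (fun i => (a i)%:Z) g p q m.
have p1 := prime_gt1 pp; have q1 := prime_gt1 pq.
have lineb (T : eqType) (pi : R -> T) (l : R) :
    \sum_(l' in hit A | pi l' == pi l) (a l')%:Z =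
    (\sum_(l' in hit A | pi l' == pi l) a l')%N%:Z.
  by rewrite [RHS](big_morph Posz PoszD (erefl _)).
have arith (n s w c d : nat) : (s <= w)%N -> (c <= d)%N ->
    n%:Z <= s%:Z + c%:Z - (m.+2 * n)%N%:Z -> (m.+3 * n <= w + d)%N.
  by rewrite [(m.+3 * n)%N]mulSn; lia.
have line_arith (n b s x : nat) :
    (b + m.+2 * x <= s + C)%N \/ (n * b + 2 * x <= s + C)%N ->
    b%:Z <= s%:Z + C%:Z - (m.+2 * x)%N%:Z \/
    n%:Z * b%:Z - m%:Z * x%:Z <= s%:Z + C%:Z - (m.+2 * x)%N%:Z.
  by rewrite -!PoszM !mulSn => -[h|h]; [left|right]; lia.
have {}total : (\sum_(i in hit A) (a i)%:Z <= \sum_(i in hit A) g i) ->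
    (m.+3 * #|` A| <= dilates_card A + k * C)%N.
  rewrite /g sumrB big_split /= -!(big_morph Posz PoszD (erefl _)) -big_distrr /=.
  rewrite sum_card_hit sum_nat_const.
  have : (#|hit A| * C <= k * C)%N by rewrite leq_mul2r (leq_trans jm (ltnW mk)) orbT.
  by move=> jC; apply: arith sX jC.
move=> H; apply: total; apply: H; rewrite ?lez_nat ?(ltnW p1) ?(ltnW q1) //.
- by rewrite addn1.
- have /fset0Pn[x Ax] : A != fset0 by rewrite -cardfs_gt0 ltnW.
  by apply/set0Pn; exists (residue x); apply: mem_hit.
- by move=> i _; apply: hit_fst.
- by move=> i _; apply: hit_snd.
- move=> i Ji; have IHi' := IHi _ Ji.
  have [fX|h|h|h] := FpFq_gain A i pp pq pneq residueD (X0 _ Ji).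
  + constructor 1 => l Jl; have := full_dsum_ge residueD l fX mA.
    by rewrite card_residue cX -/(a i) -/(a l) -/(t i) /g -!PoszM !mulSn; lia.
  + constructor 2 => l Jl /eqP/h; rewrite mul1n -/(a l) -/(t i) /g; lia.
  + constructor 3 => l Jl /eqP/h; rewrite -/(a l) -/(t i) /g -PoszM; lia.
  + constructor 4 => l Jl /eqP/h; rewrite -/(a l) -/(t i) /g -PoszM; lia.
- move=> i l Ji Jl sl b; rewrite /b lineb.
  have := @line_gain q snd A (X i) i l m C pq qk _ mA (X0 _ Ji) (cX i) sl kC (IHi _ Ji).
  by rewrite cX => h; apply: line_arith; apply: h.
- move=> i l Ji Jl sl b; rewrite /b lineb.
  have := @line_gain p fst A (X i) i l m C pp pk _ mA (X0 _ Ji) (cX i) sl kC (IHi _ Ji).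
  by rewrite cX => h; apply: line_arith; apply: h.
Qed.

Lemma two_classes A : reduced A -> (0 < #|` A|)%N -> (2 <= #|hit A|)%N.
Proof.
rewrite cardfs_gt0 => rA /fset0Pn[x Ax]; have [l Jl ne] := hit_fst (residue x) rA.
have <- : #|[set residue x; l]| = 2%N.
  by rewrite cards2; case: eqP ne => // ->.
by apply/subset_leq_card/subsetP => i /set2P[] -> //; apply: mem_hit.
Qed.

Lemma weak_bound_base : weak_bound 2 (4 * k).
Proof.
have k15 := pq_ge15; apply: weak_reduce => [|A rA A1]; first by lia.
have := many_classes rA (ltnW A1); have := two_classes rA (ltnW A1); nia.
Qed.

Lemma weak_bound_all n : (n + 2 <= k)%N -> weak_bound (n + 2) (4 * k ^ n.+1).
Proof.
have k15 := pq_ge15; elim: n => [|n IH] nk; first by rewrite expn1; apply: weak_bound_base.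
have -> : (4 * k ^ n.+2 = k * (4 * k ^ n.+1))%N by rewrite expnS mulnCA.
have k0 : (0 < k)%N by apply: leq_trans k15.
have kn : (0 < k ^ n)%N by rewrite expn_gt0 k0.
have kkn : (k <= k ^ n.+1)%N by rewrite expnS leq_pmulr.
by apply: weak_bound_step => //; [apply: leq_mul|apply: IH; apply: ltnW].
Qed.

Lemma weak_bound_k : weak_bound k (4 * k ^ k.-1).
Proof.
have k15 := pq_ge15; have e : (k - 2).+1 = k.-1 by move: k15; move: k => K; lia.
have k2 : (2 <= k)%N by apply: leq_trans k15.
by have := @weak_bound_all (k - 2); rewrite e (subnK k2) => /(_ (leqnn _)).
Qed.

(** * The bound for large sets *)

(** The arithmetic of the cases of [strong_bound]: K is the modulus, n the size of A,
    w that of the sum of dilates. Here e and o count the even and the odd elements,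
    and the inequality between the squares of K + 1 and 2j bounds 2j(K + 1 - j). *)
Lemma all_full_arith (K n e o j s1 s2 w : nat) : (15 <= K -> e + o = n -> s1 + s2 <= w ->
    n + K * e + j * j <= s1 + K * j + j -> n + K * o + j * j <= s2 + K * j + j ->
    K.+2 * n + 2 <= w + K ^ 2 + K)%N.
Proof.
move=> k15 <- h1 h2 h3; have [sq _] := nat_Cauchy K.+1 (2 * j).
have KK : (15 * K <= K * K)%N by rewrite leq_mul2r k15 orbT.
move: h2 h3 sq KK; rewrite -!mulnn; lia.
Qed.

Lemma all_classes_arith (K n w : nat) : (15 <= K -> 2 * n + K * n <= w + 2 * K ->
  K.+2 * n + 2 <= w + K ^ 2 + K)%N.
Proof. by move=> k15; have := leq_mul k15 (leqnn K); rewrite -mulnn; lia. Qed.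

Lemma small_class_arith (K C n al tl sa st w j : nat) : (15 <= K -> K ^ 3 <= C -> 2 * K * C < n ->
  al < C + 2 * K ^ 2 -> j.+1 < K -> al + sa = n -> tl + st <= w ->
  2 * al + n <= tl + 2 -> K.+2 * sa <= st + j * C -> K.+2 * n + 2 <= w + K ^ 2 + K)%N.
Proof.
move=> k15 kC nC alC jK e h1 h2 h3; subst n.
have e3 : (K ^ 3 = K * (K ^ 2))%N by rewrite -expnS.
have h4 : (K * al <= K * (C + 2 * K ^ 2))%N by rewrite leq_mul2l ltnW ?orbT.
have h5 : ((j + 2) * C <= K * C)%N by rewrite leq_mul2r; apply/orP; right; lia.
move: nC alC h2 h3 h4 h5 kC; rewrite e3 -!mulnn.
by move=> nC _ h2 h3 h4 h5 kC; have := leq_mul (leqnn K) (ltnW k15); lia.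
Qed.

Lemma nonfull_class_arith (K n al tl sa st w j : nat) : (15 <= K -> j.+1 < K ->
  al + sa = n -> tl + st <= w -> K.+2 * al + 2 * K ^ 2 <= tl ->
  K.+2 * sa <= st + j * (2 * K) -> K.+2 * n + 2 <= w + K ^ 2 + K)%N.
Proof.
move=> k15 jK <- h1 h2 h3.
have h5 : (j * (2 * K) <= K * (2 * K))%N by rewrite leq_mul2r; apply/orP; right; lia.
move: h2 h3 h5; rewrite -!mulnn; lia.
Qed.

(** A is not contained in a line, so each type of stabilizer leaves some class that
    produces a gain. *)
Lemma nonfull_gain A (X : {fset int}) i : reduced A -> X != fset0 ->
  full residue X \/
  exists2 l, l \in hit A &
    (#|` dsum X (fiber residue A i)| + #|` fiber residue A l| <=
     #|` dsum X A|)%N.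
Proof.
move=> rA X0; have [l1 Jl1 n1] := hit_fst i rA; have [l2 Jl2 n2] := hit_snd i rA.
have p0 := prime_gt0 pp; have q0 := prime_gt0 pq.
have ge n a b c : (0 < n -> a + n * b <= c -> a + b <= c)%N.
  by move=> n0; apply: leq_trans; rewrite leq_add2l leq_pmull.
have [fX|h|h|h] := FpFq_gain A i pp pq pneq residueD X0; first by left.
- by right; exists l1 => //; apply: (ge 1%N) => //; apply: h; apply/eqP => e; apply: n1; rewrite e.
- by right; exists l2 => //; apply: (ge p) => //; apply: h; apply/eqP.
- by right; exists l1 => //; apply: (ge q) => //; apply: h; apply/eqP.
Qed.

(** Adding [full_family_ge] for the even and the odd part of A, the loss with j
    classes is 2j(k + 1 - j). *)
Lemma all_full_bound A (X : R -> {fset int}) : reduced A ->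
  (forall i, #|` X i| = #|` fiber residue A i|) ->
  (\sum_(i in hit A) #|` dsum (X i) A| <= dilates_card A)%N ->
  (forall i, i \in hit A -> full residue (X i)) ->
  (k.+2 * #|` A| + 2 <= dilates_card A + k ^ 2 + k)%N.
Proof.
move=> rA cX sX fX; have mA := reduced_mixed rA.
have half e : (#|` A| + k * #|` fiber evenz A e| + #|hit A| * #|hit A| <=
    \sum_(i in hit A) #|` dsum (X i) (fiber evenz A e)| + k * #|hit A| + #|hit A|)%N.
  rewrite -{1}(sum_card_hit A) -card_residue.
  rewrite -(eq_bigr _ (fun i _ => cX i)).
  apply: full_family_ge fX; [exact: residueD|exact: mixed_fiber|].
  by move=> b; rewrite in_fiber => /andP[Ab _]; apply: mem_hit.
have par : (\sum_(i in hit A) #|` dsum (X i) (fiber evenz A true)| +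
    \sum_(i in hit A) #|` dsum (X i) (fiber evenz A false)| <= dilates_card A)%N.
  rewrite -big_split /=; apply: leq_trans sX; apply: leq_sum => i _; exact: dsum_parity.
exact: all_full_arith pq_ge15 (card_parity A) par (half true) (half false).
Qed.

(** The threshold gives |A| > 2kC for the constant C = 4k^(k-1) of the weak bound.
    The margin 2k^2 added to C in the case distinction covers the loss of at most
    2k in each of the fewer than k full classes. *)
Lemma strong_bound A : reduced A -> (8 * k ^ k < #|` A|)%N ->
  (k.+2 * #|` A| + 2 <= dilates_card A + k ^ 2 + k)%N.
Proof.
move=> rA Abig; have k15 := pq_ge15; have A0 : (0 < #|` A|)%N by apply: leq_trans Abig.
have mA := reduced_mixed rA.
pose C := (4 * k ^ k.-1)%N.
have CA : (2 * k * C < #|` A|)%N.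
  move: Abig; rewrite -[X in (_ * _ ^ X < _)%N](@prednK k) ?expnS; last by apply: leq_trans k15.
  by rewrite /C; lia.
have kC : (k ^ 3 <= C)%N.
  by rewrite /C; apply: leq_trans (leq_pmull _ _) => //; rewrite leq_exp2l; lia.
have [jk|kj] := leqP k #|hit A|.
  have e : #|hit A| = k by apply/eqP; rewrite eqn_leq jk -card_residue max_card.
  by have := many_classes rA A0; rewrite e; apply: all_classes_arith.
have [X [cX sX wX X0]] := hit_decomposition A.
pose a i := #|` fiber residue A i|; pose t i := #|` dsum (X i) A|.
have weak i : i \in hit A ->
    (k.+2 * a i <= #|` dsum (X i) (fiber residue A i)| + C)%N.
  by move=> Ji; rewrite -wX; apply: weak_bound_k; move: Ji; rewrite inE.
have tge i : (#|` dsum (X i) (fiber residue A i)| <= t i)%N.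
  apply/fsubset_leq_card/fsubsetP => z /dsumP[x [y [Xx Fy ->]]].
  by apply/dsumP; exists x, y; split=> //; apply: (fsubsetP (fiber_sub residue A i)).
have suma : (\sum_(i in hit A) a i = #|` A|)%N by apply: sum_card_hit.
have sumt : (\sum_(i in hit A) t i <= dilates_card A)%N by [].
have peel (F : R -> nat) i : i \in hit A ->
    (\sum_(l in hit A) F l = F i + \sum_(l in hit A :\ i) F l)%N.
  move=> Ji; rewrite (bigD1 i) //=; congr addn; apply: eq_bigl => l.
  by rewrite !inE andbC.
(* For a small class, t l is at least |A| - 2, while k (a l) is at most kC + 2k^3
   and kC is less than half of |A|. *)
case: (boolP [exists l in hit A, (a l < C + 2 * k ^ 2)%N]) => [/exists_inP[l Jl al]|].
  have tl : (2 * a l + #|` A| <= t l + 2)%N by rewrite /a -cX; apply: mixed_dsum_ge (X0 _ Jl) mA.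
  have rest : (k.+2 * \sum_(i in hit A :\ l) a i <=
      \sum_(i in hit A :\ l) t i + #|hit A :\ l| * C)%N.
    rewrite -sum_nat_const -big_split big_distrr /=; apply: leq_sum => i.
    rewrite !inE => /andP[_ Ji]; have := @weak i; rewrite inE => /(_ Ji); have := tge i; lia.
  have jk : (#|hit A :\ l|.+1 < k)%N by move: kj; rewrite (cardsD1 l (hit A)) Jl.
  rewrite (peel _ l Jl) in suma; rewrite (peel _ l Jl) in sumt.
  exact: small_class_arith k15 kC CA al jk suma sumt tl rest.
move/exists_inPn => large.
have {}large l : l \in hit A -> (C + 2 * k ^ 2 <= a l)%N by move=> /large; rewrite -leqNgt.
have cls i : i \in hit A -> full residue (X i) \/ (k.+2 * a i + 2 * k ^ 2 <= t i)%N.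
  move=> Ji; have [fX|[l Jl gl]] := nonfull_gain i rA (X0 _ Ji); [by left|right].
  by have := weak _ Ji; have := large _ Jl; move: gl; rewrite -/(a l) -/(t i); lia.
have fullt i : full residue (X i) -> (k.+2 * a i <= t i + 2 * k)%N.
  move=> fX; have := full_dsum_ge residueD i fX mA; rewrite card_residue cX -/(a i) -/(t i); lia.
case: (boolP [forall i in hit A, (t i < k.+2 * a i + 2 * k ^ 2)%N]) => [/forall_inP h|].
  apply: (all_full_bound rA cX sX) => i Ji; have [//|] := cls i Ji.
  by rewrite leqNgt h.
case/forall_inPn => i0 Ji0; rewrite -leqNgt => ti0.
have rest : (k.+2 * \sum_(i in hit A :\ i0) a i <=
      \sum_(i in hit A :\ i0) t i + #|hit A :\ i0| * (2 * k))%N.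
  rewrite -sum_nat_const -big_split big_distrr /=; apply: leq_sum => i.
  rewrite 2!inE => /andP[_ Ji]; have [/fullt//|] := cls _ Ji; lia.
have jk : (#|hit A :\ i0|.+1 < k)%N by move: kj; rewrite (cardsD1 i0 (hit A)) Ji0.
rewrite (peel _ i0 Ji0) in suma; rewrite (peel _ i0 Ji0) in sumt.
exact: nonfull_class_arith k15 jk suma sumt ti0 rest.
Qed.

End TwoPrimes.

Theorem theorem2 (k p q : nat) (hp : prime p) (hq : prime q)
    (p_odd : odd p) (q_odd : odd q) (hpq : p <> q) (hk : k = (p * q)%N)
    (A : {fset int}) (hA : (8 * k ^ k < #|` A|)%N) :
  (k%:Z + 2) * #|` A|%:Z - k%:Z ^+ 2 - k%:Z + 2
    <= #|` sumset (dilate 2 A) (dilate k%:Z A)|%:Z.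
Proof.
have k15 := pq_ge15 hp hq p_odd q_odd hpq; rewrite -hk in k15.
have A1 : (1 < #|` A|)%N.
  by apply: leq_ltn_trans hA; rewrite muln_gt0 expn_gt0 (leq_trans _ k15).
have [B [rB cB wB]] := exists_reduced k%:Z A1.
rewrite -wB -cB; rewrite -cB hk in hA.
have := strong_bound hp hq p_odd q_odd hpq rB hA; rewrite /dilates_card -hk -!mulnn.
rewrite mulSn mulSn expr2.
move: #|` B| #|` sumset _ _| => n w h; lia.
Qed.
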